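(* Let $f: M^n\to M^n$ be a Smale-Vietoris A-diffeomorphism of a closed $n$-manifold $M^n$, let $\mathfrak{B}=\mathbb{T}^k\times N\subset M^n$ be the support of the Smale skew-mapping $F=f|_{\mathfrak{B}}$, $F(t,z)=(g(t),\omega(t,z))$, where $g:\mathbb{T}^k\to\mathbb{T}^k$ is an A-endomorphism. Let $\Omega$ be a basic set of $g$, let $\mathfrak{S}=\bigcap_{l\ge 0}F^l(\mathbb{T}^k\times N)$, and let $p_1:\mathbb{T}^k\times N\to\mathbb{T}^k$ be the natural projection on the first factor. Then $\mathfrak{S}\cap p_1^{-1}(\Omega)$ contains a unique basic set $\Omega_{\mathfrak{S}}$ of $f$. Moreover: 1. If $\Omega$ is a trivial basic set (an isolated periodic orbit) of $g$, then $\Omega_{\mathfrak{S}}$ is also a trivial basic set. 2. If $\Omega$ is a nontrivial basic set of $g$, then $\Omega_{\mathfrak{S}}$ is also a nontrivial basic set. 3. If $\Omega$ is a backward $g$-invariant basic set of $g$, i.e. $\Omega=g^{-1}(\Omega)$ (hence $\Omega$ is nontrivial), then $\Omega_{\mathfrak{S}}=\mathfrak{S}\cap p_1^{-1}(\Omega)$.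
   Context: Smale skew-mappings. $\mathbb{T}^k$ is the $k$-dimensional torus, $k\in\mathbb{N}$, and $N$ is an $(n-k)$-dimensional compact Riemannian manifold with non-empty boundary, $n-k\ge 1$. For $N_1\subset N$, $\mathrm{diam}\,N_1$ is its diameter in the metric of $N$; the diameter of a subset of a fiber $\{t\}\times N$ is that of the corresponding subset of $N$. A surjective map $g:\mathbb{T}^k\to\mathbb{T}^k$ is a $d$-cover if it is an orientation preserving local homeomorphism of degree $d$. A map $F:\mathbb{T}^k\times N\to\mathbb{T}^k\times N$, $F(t,z)=(g(t),\omega(t,z))$, is a Smale skew-mapping if: (i) $F$ is a diffeomorphism onto its image; (ii) $g$ is a $d$-cover with $d\ge 2$; (iii) for each $t$, $F$ restricted to $\{t\}\times N$ is an embedding into $\mathrm{int}(\{g(t)\}\times N)$, and this is uniformly attracting: there are $0<\lambda<1$, $C>0$ with $\mathrm{diam}(F^m(\{t\}\times N))\le C\lambda^m\,\mathrm{diam}(\{t\}\times N)$ for all $t$ and all $m\in\mathbb{N}$. A diffeomorphism $f:M^n\to M^n$ is Smale-Vietoris if there is an $n$-submanifold $\mathfrak{B}=\mathbb{T}^k\times N\subset M^n$ such that $F=f|_{\mathfrak{B}}$ is a Smale skew-mapping; $\mathfrak{B}$ is called the support of the Smale skew-mapping. Non-wandering sets and axiom A. A point $x$ is non-wandering for a map $g$ if for each neighborhood $U$ of $x$ there is $m\in\mathbb{N}$ (positive) with $g^m(U)\cap U\ne\emptyset$; $NW(g)$ is the set of non-wandering points. A $C^1$ endomorphism $g$ (a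 $C^1$ map of a closed manifold onto itself) is nonsingular if its Jacobian vanishes nowhere; the endomorphisms considered are nonsingular and not diffeomorphisms. A $g$-orbit of $x_0$ is a bi-infinite sequence $\{x_i\}_{i\in\mathbb{Z}}$ with $g(x_i)=x_{i+1}$. It is hyperbolic if there is a continuous $Dg$-invariant splitting $\mathbb{E}^s_{x_i}\oplus\mathbb{E}^u_{x_i}$ of the tangent spaces along it and constants $c>0$, $0<\mu<1$ with $\|Dg^m v\|\le c\mu^m\|v\|$ for $v\in\mathbb{E}^s$ and $\|Dg^m w\|\ge c^{-1}\mu^{-m}\|w\|$ for $w\in\mathbb{E}^u$, $m\in\mathbb{N}$. A nonsingular $g$ is an A-endomorphism if periodic $g$-orbits are dense in $NW(g)$ and all $g$-orbits in $NW(g)$ are hyperbolic, with the splitting depending continuously on the compact (finite) parts of the orbits. An A-diffeomorphism is a diffeomorphism satisfying Smale's axiom A. By the spectral decomposition theorem the non-wandering set of an A-endomorphism (or A-diffeomorphism) is a finite disjoint union of closed invariant sets ($g(\Omega_i)=\Omega_i$), each containing a point whose orbit is dense in it; these are the basic sets. A basic set is trivial if it is an isolated periodic orbit, and nontrivial otherwise. *)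

(* Defs.v *)
From HB Require Import structures.
From mathcomp Require Import all_boot all_order all_algebra.
From mathcomp Require Import all_classical all_reals all_analysis.

Set Implicit Arguments.
Unset Strict Implicit.
Unset Printing Implicit Defensive.

Import Order.TTheory GRing.Theory Num.Theory.
Import numFieldNormedType.Exports.

Local Open Scope classical_set_scope.
Local Open Scope ring_scope.

Section Dynamics.
Context {M : topologicalType}.
Implicit Types (g : M -> M) (A : set M) (D : set (set M)).

Definition is_orbit g (x : int -> M) := forall i, x (i + 1) = g (x i).

Definition nonwandering g : set M :=
  [set x | forall U, nbhs x U ->
     exists2 m, (0 < m)%N & (iter m g @` U) `&` U !=set0].

Definition periodic_point g : set M :=
  [set x | exists2 p, (0 < p)%N & iter p g x = x].

(* If [g] is invertible, the orbits are exactly the full orbits of points. *)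
Definition has_dense_orbit g A :=
  exists x, [/\ is_orbit g x, forall i, A (x i) & A `<=` closure (range x)].

Definition invariant_partition g D :=
  [/\ finite_set D, trivIset D id, \bigcup_(A in D) A = nonwandering g &
      forall A, D A -> closed A /\ g @` A = A].

Definition spectral_decomposition g D :=
  invariant_partition g D /\ forall A, D A -> has_dense_orbit g A.

(* A piece of the spectral decomposition.  Transitivity is only recorded for
   the piece under consideration, so that the definition does not refer to the
   other ones; [basic_setE] shows that the basic sets are exactly the members
   of the spectral decomposition. *)
Definition basic_set g A :=
  has_dense_orbit g A /\ exists2 D, invariant_partition g D & D A.

Definition trivial_set g A :=
  (exists x, periodic_point g x /\ A = [set iter i g x | i in setT]) /\
  (exists2 U, open U & U `&` nonwandering g = A).

Lemma orbit_in_piece g D (x : int -> M) : invariant_partition g D ->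
  is_orbit g x -> (forall i, nonwandering g (x i)) ->
  exists2 A, D A & forall i, A (x i).
Proof.
move=> [_ Dtriv Dcov Dinv] ox NWx.
have fwd A i n : D A -> A (x i) -> A (x (i + n%:Z)).
  move=> DA Ai; elim: n => [|n IHn]; first by rewrite addr0.
  rewrite -addn1 PoszD addrA ox; have [_ <-] := Dinv A DA.
  by exists (x (i + n%:Z)).
have piece i : exists2 A, D A & A (x i).
  by have := NWx i; rewrite -Dcov => -[A DA Ai]; exists A.
have [A DA A0] := piece 0; exists A => // -[] n.
  by rewrite -[Posz n]add0r; exact: fwd.
have [B DB Bn] := piece (Negz n).
have B0 : B (x 0) by have := fwd _ _ n.+1 DB Bn; rewrite NegzE addNr.
suff -> : A = B by [].
by apply: Dtriv => //; exists (x 0).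
Qed.

Lemma basic_setE g D A :
  spectral_decomposition g D -> basic_set g A <-> D A.
Proof.
move=> [Dpart Ddense]; split; last first.
  by move=> DA; split; [exact: Ddense | exists D].
move=> [[x [ox Ax clx]] [D' D'part D'A]].
have NWx i : nonwandering g (x i).
  by have [_ _ <- _] := D'part; exists A.
have [B DB Bx] := orbit_in_piece Dpart ox NWx.
have AB : A `<=` B.
  have [_ _ _ /(_ B DB)[cB _]] := Dpart.
  apply: subset_trans clx _; rewrite [X in _ `<=` X](closure_id B).1 //.
  by apply: closureS => _ [i _ <-].
have [y [oy By cly]] := Ddense B DB.
have NWy i : nonwandering g (y i).
  by have [_ _ <- _] := Dpart; exists B.
have [C D'C Cy] := orbit_in_piece D'part oy NWy.
have BC : B `<=` C.
  have [_ _ _ /(_ C D'C)[cC _]] := D'part.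
  apply: subset_trans cly _; rewrite [X in _ `<=` X](closure_id C).1 //.
  by apply: closureS => _ [i _ <-].
have AC : A = C.
  have [_ D'triv _ _] := D'part; apply: D'triv => //.
  by exists (x 0); split => //; exact/BC/AB.
by have -> : A = B by apply/seteqP; split=> //; rewrite AC.
Qed.

End Dynamics.

Section Calculus.
Context {R : realType} {n1 n2 : nat}.
Implicit Types (A : set 'rV[R]_n1) (f h : 'rV[R]_n1 -> 'rV[R]_n2)
  (a : 'rV[R]_n1).

(* [h] is of class C^1 near [a] and extends [f] restricted to [A]. *)
Definition C1_extension A f a h :=
  (\forall v \near a, differentiable h v /\ {for v, continuous (jacobian h)}) /\
  (\forall v \near a, A v -> h v = f v).

Definition C1_at A f a := exists h, C1_extension A f a h.

(* The matrix acts on row vectors.  It does not depend on the extension when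
   [A] is a relatively open subset of a half-space containing [a]. *)
Definition deriv_in A f a : 'M[R]_(n1, n2) :=
  xget 0 [set J | exists2 h, C1_extension A f a h & J = jacobian h a].

End Calculus.

(* An atlas is given by one chart around each point: [cmap c x] is the
   coordinate map on the domain [cdom c x], with inverse [cinv c x].  The
   tangent space at [x] is represented by 'rV[R]_n through the chart around
   [x]. *)
Record charts (R : realType) (M : Type) (n : nat) := Charts {
  cdom : M -> set M;
  cmap : M -> M -> 'rV[R]_n;
  cinv : M -> 'rV[R]_n -> M }.

Section Manifolds.
Context {R : realType} {M : topologicalType} {n : nat}.
Implicit Types c : charts R M n.

Definition crange c x := cmap c x @` cdom c x.

Definition transition_dom c x y := cmap c x @` (cdom c x `&` cdom c y).
Definition transition c x y := cmap c y \o cinv c x.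

(* Derivative at [p] of the change of coordinates from the chart around [x]
   to the chart around [y]. *)
Definition chart_change c x y p : 'M[R]_n :=
  deriv_in (transition_dom c x y) (transition c x y) (cmap c x p).

Definition C1_manifold c :=
  [/\ forall x, open (cdom c x) /\ cdom c x x,
      forall x, {within cdom c x, continuous (cmap c x)} /\
                {within crange c x, continuous (cinv c x)},
      forall x y, cdom c x y -> cinv c x (cmap c x y) = y,
      forall x, exists2 V : set 'rV[R]_n, open V &
        crange c x = V \/ exists i, crange c x = V `&` [set v | 0 <= v 0 i] &
      forall x y p, cdom c x p -> cdom c y p ->
        C1_at (transition_dom c x y) (transition c x y) (cmap c x p)].

Definition interior_point c : set M :=
  [set x | nbhs (cmap c x x) (crange c x)].

Definition boundary_point c : set M := ~` interior_point c.

Definition closed_manifold c :=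
  [/\ C1_manifold c, hausdorff_space M, compact [set: M] &
      boundary_point c = set0].

(* [q x] is the Gram matrix, in the chart around [x], of the scalar product on
   the tangent space at [x]. *)
Definition tnorm (q : M -> 'M[R]_n) x (v : 'rV[R]_n) : R :=
  Num.sqrt ((v *m q x *m v^T) 0 0).

Definition riemannian_metric c (q : M -> 'M[R]_n) :=
  [/\ forall x, (q x)^T = q x,
      forall x (v : 'rV[R]_n), v != 0 -> 0 < (v *m q x *m v^T) 0 0 &
      forall x, (fun y => chart_change c x y y *m q y *m
                          (chart_change c x y y)^T) @ x --> q x].

Definition C1_curve c (gam : R -> M) :=
  continuous gam /\
  forall s, \forall u \near s,
    derivable (cmap c (gam s) \o gam) u 1 /\
    {for u, continuous (derive1 (cmap c (gam s) \o gam))}.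

Definition velocity c (gam : R -> M) (s : R) : 'rV[R]_n :=
  derive1 (cmap c (gam s) \o gam) s.

Definition curve_length c q (gam : R -> M) : \bar R :=
  (\int[lebesgue_measure]_(s in `[0%R, 1%R]) (tnorm q (gam s) (velocity c gam s))%:E)%E.

End Manifolds.

(* The distance of the metric space [N] is the geodesic distance of the
   Riemannian metric [q]; its finiteness makes [N] connected.  The infimum over
   curves of class C^1 on the whole line is the one over piecewise C^1 paths,
   which can be reparametrized so as to stop at their corners and ends. *)
Definition riemannian_distance (R : realType) (N : metricType R) (n : nat)
    (c : charts R N n) (q : N -> 'M[R]_n) :=
  forall x y : N, (mdist x y)%:E =
    ereal_inf [set curve_length c q gam | gam in
                [set gam | [/\ C1_curve c gam, gam 0 = x & gam 1 = y]]].

Definition compact_riemannian_manifold_with_boundary (R : realType)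
    (N : metricType R) (n : nat) (c : charts R N n) (q : N -> 'M[R]_n) :=
  [/\ C1_manifold c, compact [set: N], boundary_point c !=set0,
      riemannian_metric c q & riemannian_distance c q].

Definition diam (R : realType) (N : metricType R) (A : set N) : \bar R :=
  ereal_sup [set (mdist p.1 p.2)%:E | p in A `*` A].

Section Maps.
Context {R : realType} {M1 M2 : topologicalType} {n1 n2 : nat}.
Variables (c1 : charts R M1 n1) (c2 : charts R M2 n2).
Implicit Types h : M1 -> M2.

Definition local_dom h x :=
  cmap c1 x @` (cdom c1 x `&` h @^-1` cdom c2 (h x)).
Definition local_expr h x := cmap c2 (h x) \o h \o cinv c1 x.

Definition C1_map h :=
  continuous h /\ forall x, C1_at (local_dom h x) (local_expr h x) (cmap c1 x x).

Definition tmap h x : 'M[R]_(n1, n2) :=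
  deriv_in (local_dom h x) (local_expr h x) (cmap c1 x x).

(* In equal dimensions, this is a diffeomorphism onto the image. *)
Definition C1_embedding h :=
  [/\ C1_map h, injective h, forall x, row_free (tmap h x) &
      forall U, open U -> exists2 V, open V & h @` U = V `&` range h].

End Maps.

Definition diffeomorphism (R : realType) (M1 M2 : topologicalType)
    (n1 n2 : nat) (c1 : charts R M1 n1) (c2 : charts R M2 n2) (h : M1 -> M2) :=
  C1_map c1 c2 h /\
  exists hV, [/\ cancel h hV, cancel hV h & C1_map c2 c1 hV].

Section Product.
Context {R : realType} {M1 M2 : Type} {n1 n2 : nat}.

Definition prod_charts (c1 : charts R M1 n1) (c2 : charts R M2 n2) :
    charts R (M1 * M2) (n1 + n2) :=
  {| cdom := fun x => cdom c1 x.1 `*` cdom c2 x.2;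
     cmap := fun x y => row_mx (cmap c1 x.1 y.1) (cmap c2 x.2 y.2);
     cinv := fun x v => (cinv c1 x.1 (lsubmx v), cinv c2 x.2 (rsubmx v)) |}.

End Product.

Section Torus.
Context (R : realType) (k : nat).
Local Open Scope quotient_scope.

Definition lattice_equiv (u v : 'rV[R]_k) : bool :=
  [forall i, (u 0 i - v 0 i) \is a Num.int].

Lemma lattice_equiv_refl : reflexive lattice_equiv.
Proof. by move=> u; apply/forallP => i; rewrite subrr rpred0. Qed.

Lemma lattice_equiv_sym : symmetric lattice_equiv.
Proof.
by move=> u v; apply/forallP/forallP => h i; rewrite -opprB rpredN.
Qed.

Lemma lattice_equiv_trans : transitive lattice_equiv.
Proof.
move=> v u w /forallP uv /forallP vw; apply/forallP => i.
by rewrite -(subrKA (v 0 i)) rpredD.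
Qed.

Canonical lattice_equiv_rel := EquivRel lattice_equiv
  lattice_equiv_refl lattice_equiv_sym lattice_equiv_trans.

Definition torus := quotient_topology {eq_quot lattice_equiv_rel}.

(* Local inverses of the projection; the norm is the sup norm, so that two
   points of an open ball of radius 1/2 are never equivalent. *)
Definition torus_charts : charts R torus k :=
  {| cdom := fun t => [set \pi_torus v | v in ball (repr t : 'rV[R]_k) 2^-1];
     cmap := fun t s => xget (repr t : 'rV[R]_k)
       [set v | ball (repr t : 'rV[R]_k) 2^-1 v /\ \pi_torus v = s];
     cinv := fun _ v => \pi_torus v |}.

End Torus.

Section Hyperbolicity.
Context {R : realType} {M : topologicalType} {n : nat}.
Variables (c : charts R M n) (q : M -> 'M[R]_n).

(* Linear subspaces are row spaces of square matrices. *)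
Definition is_splitting (Es Eu : 'M[R]_n) :=
  (Es :&: Eu)%MS = 0 /\ (Es + Eu == 1%:M)%MS.

Definition hyperbolic_bounds (g : M -> M) (x : M) (Es Eu : 'M[R]_n)
    (C mu : R) :=
  forall m (v : 'rV[R]_n), (0 < m)%N ->
    ((v <= Es)%MS -> tnorm q (iter m g x) (v *m tmap c c (iter m g) x)
                       <= C * mu ^+ m * tnorm q x v) /\
    ((v <= Eu)%MS -> C^-1 * mu ^- m * tnorm q x v
                       <= tnorm q (iter m g x) (v *m tmap c c (iter m g) x)).

Definition hyperbolic_orbit (g : M -> M) (x : int -> M)
    (Es Eu : int -> 'M[R]_n) :=
  [/\ forall i, is_splitting (Es i) (Eu i),
      forall i, (Es i *m tmap c c g (x i) == Es (i + 1)%R)%MS,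
      forall i, (Eu i *m tmap c c g (x i) == Eu (i + 1)%R)%MS &
      exists C mu, [/\ 0 < C, 0 < mu < 1 &
        forall i, hyperbolic_bounds g (x i) (Es i) (Eu i) C mu]].

(* The projection onto [Es] along [Eu], subspaces of the tangent space at [y],
   read in the chart around [a]. *)
Definition splitting_proj (a y : M) (Es Eu : 'M[R]_n) : 'M[R]_n :=
  chart_change c a y y *m proj_mx Es Eu *m chart_change c y a y.

End Hyperbolicity.

Section AxiomA.
Context {R : realType} {M : topologicalType} {n : nat}.
Variable c : charts R M n.

Definition shift_seq (i : int) (x : int -> M) : int -> M := fun j => x (j + i).

(* Orbits contained in NW(g); with the topology of pointwise convergence, two
   orbits are close when they are so on a finite part. *)
Definition nw_orbits (g : M -> M) : set {ptws int -> M} :=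
  [set x | is_orbit g x /\ forall i, nonwandering g (x i)].

(* [Es x] and [Eu x] are subspaces of the tangent space at [x 0]. *)
Definition hyperbolic_nw_orbits (g : M -> M) :=
  exists q, riemannian_metric c q /\
  exists Es Eu : {ptws int -> M} -> 'M[R]_n,
    (forall x, nw_orbits g x ->
       hyperbolic_orbit c q g x (fun i => Es (shift_seq i x))
                                (fun i => Eu (shift_seq i x))) /\
    (forall a, nw_orbits g a ->
       (fun y : {ptws int -> M} => splitting_proj c (a 0) (y 0) (Es y) (Eu y))
         @ within (nw_orbits g) (nbhs a) --> proj_mx (Es a) (Eu a)).

Definition nonsingular (g : M -> M) := forall x, tmap c c g x \in unitmx.

Definition A_endomorphism (g : M -> M) :=
  [/\ [/\ C1_map c c g, range g = setT, nonsingular g &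
          ~ diffeomorphism c c g],
      nonwandering g `<=` closure (periodic_point g) &
      hyperbolic_nw_orbits g].

Definition hyperbolic_set (f : M -> M) (L : set M) :=
  exists q, riemannian_metric c q /\
  exists (Es Eu : M -> 'M[R]_n) (C mu : R),
    [/\ 0 < C, 0 < mu < 1,
        forall x, L x -> is_splitting (Es x) (Eu x),
        forall x, L x -> (Es x *m tmap c c f x == Es (f x))%MS /\
                         (Eu x *m tmap c c f x == Eu (f x))%MS &
        (forall x, L x -> hyperbolic_bounds c q f x (Es x) (Eu x) C mu) /\
        (forall a, L a ->
           (fun y => splitting_proj c a y (Es y) (Eu y)) @ within L (nbhs a)
             --> proj_mx (Es a) (Eu a))].

Definition A_diffeomorphism (f : M -> M) :=
  [/\ diffeomorphism c c f, hyperbolic_set f (nonwandering f) &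
      nonwandering f `<=` closure (periodic_point f)].

End AxiomA.

Section Skew.
Context {R : realType} {k : nat}.
Implicit Types g : torus R k -> torus R k.

Definition torus_jacobian g t : R :=
  \det (tmap (torus_charts R k) (torus_charts R k) g t).

Definition local_homeomorphism g :=
  continuous g /\ forall t, exists U, [/\ open U, U t, set_inj U g &
    forall V, open V -> V `<=` U -> open (g @` V)].

(* The charts of the torus differ by translations, hence the sign of the
   Jacobian in these charts is meaningful. *)
Definition orientation_preserving g :=
  forall t, torus_jacobian g t != 0 -> 0 < torus_jacobian g t.

(* Brouwer degree: the signed number of preimages of any regular value. *)
Definition has_degree g (d : nat) :=
  forall s, (forall t, g t = s -> torus_jacobian g t != 0) ->
    \sum_(t \in g @^-1` [set s]) Num.sg (torus_jacobian g t) = d%:R.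

(* The class C^1 is needed to speak of the Jacobian; it is implied by that of
   the skew-mapping. *)
Definition d_cover g (d : nat) :=
  [/\ range g = setT, C1_map (torus_charts R k) (torus_charts R k) g,
      local_homeomorphism g, orientation_preserving g & has_degree g d].

Context {N : metricType R}.
Implicit Types w : torus R k * N -> N.

Definition skew g w (p : torus R k * N) : torus R k * N := (g p.1, w p).

Definition fiber (t : torus R k) : set (torus R k * N) := [set p | p.1 = t].

Definition fiber_diam (A : set (torus R k * N)) : \bar R := diam (snd @` A).

Definition smale_skew {m : nat} (cN : charts R N m) g w :=
  let cB := prod_charts (torus_charts R k) cN in
  [/\ C1_embedding cB cB (skew g w),
      exists2 d, (2 <= d)%N & d_cover g d,
      forall t, C1_embedding cN cN (fun z => w (t, z)) /\
                forall z, interior_point cN (w (t, z)) &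
      exists lam C : R, [/\ 0 < lam < 1, 0 < C &
        forall t (j : nat), (0 < j)%N ->
          (fiber_diam (iter j (skew g w) @` fiber t)
             <= (C * lam ^+ j)%:E * fiber_diam (fiber t))%E]].

(* [emb] is the inclusion of the submanifold T^k x N into [M]. *)
Definition smale_vietoris {m : nat} (cN : charts R N m) {M : topologicalType}
    (cM : charts R M (k + m)) (f : M -> M) (emb : torus R k * N -> M) g w :=
  [/\ diffeomorphism cM cM f,
      C1_embedding (prod_charts (torus_charts R k) cN) cM emb,
      smale_skew cN g w &
      forall p, f (emb p) = emb (skew g w p)].

Definition attractor g w : set (torus R k * N) :=
  \bigcap_(l in [set: nat]) (iter l (skew g w) @` setT).

End Skew.

(* Main.v *)
Require Import Defs.
From mathcomp Require Import all_boot all_order all_algebra.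
From mathcomp Require Import all_classical all_reals all_analysis.
From mathcomp Require Import ring lra.
Import Order.TTheory GRing.Theory Num.Theory.
Import numFieldNormedType.Exports.
Local Open Scope classical_set_scope.
Local Open Scope ring_scope.

Set Implicit Arguments.
Unset Strict Implicit.
Unset Printing Implicit Defensive.

(** Write [F] for the skew-mapping, [S] for its attractor and [NW] for
    non-wandering sets.

    Attraction along the fibers identifies [S] with the inverse limit of [g]:
    every full [g]-orbit lifts to a full [F]-orbit ([orbit_lift]), only one
    ([orbit_lift_unique]), and a point of [S] is known approximately as soon as
    one coordinate of its remote past in the torus is ([nbhs_cylinder]).  The
    basic set over [Om] is the image [OmS] of [natural_extension Om], the set of
    points of [S] whose whole [F]-orbit stays over [Om].  It is the
    non-wandering part of [K] ([natural_extensionE]):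
    - periodic points of [g] are dense in [Om] and lift to periodic points of
      [F]; by [nbhs_cylinder] the latter accumulate on the whole of
      [natural_extension Om], which is therefore non-wandering;
    - conversely the orbit of a non-wandering point of [f] in [S] is
      non-wandering, so that it projects to a full [g]-orbit in [NW g]; such an
      orbit stays in a single piece of the decomposition of [NW g], which is
      [Om] if the starting point lies over [Om].

    A dense [g]-orbit in [Om] lifts to a dense orbit in [OmS], again by
    [nbhs_cylinder].  Moreover [OmS] is closed and relatively open in [NW f],
    because [Om] is so in [NW g] and because the density of the periodic points
    forces a non-wandering point close to [S] to belong to [S].  Hence [OmS] and
    its complement in [NW f] form an invariant partition, and [OmS] is a basic
    set ([basic_set_of_isolated]).  Any basic set contained in [K] is contained
    in [NW f] and [K], hence in [OmS], and inclusion between basic sets is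
    equality ([basic_set_sub_eq]).

    If [Om] is a periodic orbit, then its periodic lift is dense in
    [natural_extension Om] and finite, so that it fills it; in the other
    direction the projection of a periodic orbit is one.  If [Om] is backward
    invariant, then all orbits through points of [S] over [Om] stay over [Om],
    whence [OmS = K]; and [Om] is not a periodic orbit, since a point of [Om]
    would have a single preimage, against the degree of [g].

    The one analytic ingredient is that [emb], being of class C^1 with
    invertible derivative, sends neighborhoods of interior points to
    neighborhoods ([nbhs_image_C1_embedding]).  It is needed because wandering
    is defined in [M]: the set [emb @` U] must be a neighborhood in [M]. *)

(** * Local surjectivity of C^1 maps with invertible Jacobian *)

Lemma norm_rowmul (R : realType) n p (u : 'rV[R]_n) (B : 'M[R]_(n, p)) :
  `|u *m B| <= n%:R * `|u| * `|B|.
Proof.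
have entry q r (A : 'M[R]_(q, r)) i j : `|A i j| <= `|A|.
  rewrite [leRHS]mx_normrE.
  exact: (le_bigmax _ (fun ij => `|A ij.1 ij.2|) (i, j)).
rewrite [leLHS]mx_normrE; apply/bigmax_leP; split=> [|[i j] _ /=].
  by rewrite !mulr_ge0.
rewrite mxE (le_trans (ler_norm_sum _ _ _))//.
have -> : n%:R * `|u| * `|B| = \sum_(l < n) `|u| * `|B|.
  by rewrite sumr_const card_ord -mulrA mulr_natl.
by apply: ler_sum => l _; rewrite normrM ler_pM.
Qed.

Lemma differentiable_jacobian_near (R : realType) n
    (h : 'rV[R]_n -> 'rV[R]_n) a (K : R) :
  differentiable h a -> 0 < K ->
  \forall u \near 0, `|h (a + u) - h a - u *m jacobian h a| <= K * `|u|.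
Proof.
move=> dh K0.
have /eqaddoP/(_ K K0) :
    h \o shift a = cst (h a) + 'd h a +o_ (0 : 'rV[R]_n) id.
  by have /diff_locallyP[] := dh.
apply: filterS => u.
by rewrite /jacobian mul_rV_lin1 /= fctE /= opprD addrA [u + a]addrC.
Qed.

(** The linear part of [h] expands by at least the inverse of the norm of
    [invmx (jacobian h a)], which the remainder cannot compensate near [a]. *)
Lemma differentiable_locally_neq (R : realType) n (h : 'rV[R]_n -> 'rV[R]_n) a :
  differentiable h a -> jacobian h a \in unitmx ->
  \forall x \near a, x != a -> h x != h a.
Proof.
move=> dh uJ; set J := jacobian h a in uJ.
pose K := n%:R * `|invmx J| + 1.
have K0 : 0 < K by rewrite ltr_wpDl// mulr_ge0.
have iK0 : 0 < (K * 2)^-1 by rewrite invr_gt0 mulr_gt0.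
have := differentiable_jacobian_near dh iK0; rewrite (near_shift a).
rewrite sub0r; apply: filterS => x /=; rewrite [a + _]addrC subrK -/J => xa.
apply: contra_neq => hxa; apply/eqP; rewrite -subr_eq0 -normr_le0.
move: xa; rewrite hxa subrr sub0r normrN => xa.
have : `|x - a| <= K * `|(x - a) *m J|.
  rewrite -[in leLHS](mulmxK uJ (x - a)) (le_trans (norm_rowmul _ _))//.
  by rewrite /K mulrDl mul1r mulrAC lerDl.
move=> /le_trans /(_ (ler_wpM2l (ltW K0) xa)).
rewrite invfM mulrA mulrA divff ?gt_eqF// mul1r => xa2.
by have := normr_ge0 (x - a); lra.
Qed.

(** If [v] solves the Newton equation [v *m jacobian h c = y - h c] up to a
    quarter of the right-hand side, then a small step along [v] brings [h] closer
    to [y]; so a minimum of the distance to [y] is a solution of [h x = y]. *)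
Lemma norm_sub_descent (R : realType) n (h : 'rV[R]_n -> 'rV[R]_n) c y v :
  differentiable h c -> h c != y ->
  `|v *m jacobian h c + (h c - y)| <= `|h c - y| / 4 ->
  \forall s \near 0^'+, `|h (c + s *: v) - y| < `|h c - y|.
Proof.
move=> dc hcy vJ; set e := h c - y in vJ *.
have e0 : 0 < `|e| by rewrite normr_gt0 subr_eq0.
pose K := `|e| / (4 * (`|v| + 1)).
have K0 : 0 < K by rewrite divr_gt0// mulr_gt0// ltr_wpDl.
have Kv : K * `|v| <= `|e| / 4.
  rewrite /K invfM mulrA -mulrA ler_piMr ?divr_ge0//.
  by rewrite mulrC ler_pdivrMr ?ltr_wpDl// mul1r lerDl.
have cvgsv : s *: v @[s --> 0^'+] --> (0 : 'rV[R]_n).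
  rewrite -[X in _ --> X](scale0r v).
  by apply: cvg_at_right_filter; apply: cvgZr_tmp; exact: cvg_id.
have err : \forall s \near (0 : R)^'+,
    `|h (c + s *: v) - h c - s *: v *m jacobian h c| <= K * `|s *: v|.
  exact: cvgsv _ (differentiable_jacobian_near dc K0).
near=> s.
have s0 : 0 < s by near: s; exact: nbhs_right_gt.
have s1 : s <= 1 by near: s; exact: nbhs_right_le.
have errs : `|h (c + s *: v) - h c - s *: v *m jacobian h c| <= K * `|s *: v|.
  by near: s.
rewrite normrZ gtr0_norm// mulrCA in errs.
have -> : h (c + s *: v) - y = (1 - s) *: e + s *: (v *m jacobian h c + e) +
    (h (c + s *: v) - h c - s *: v *m jacobian h c).
  rewrite -scalemxAl /e; move: (v *m _) (h (c + _)) (h c) => w h1 h0.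
  by apply/rowP => i; rewrite !mxE; ring.
rewrite (le_lt_trans (ler_normD _ _))//.
have := ler_normD ((1 - s) *: e) (s *: (v *m jacobian h c + e)).
rewrite !normrZ (gtr0_norm s0) ger0_norm ?subr_ge0// => tri.
have := ler_wpM2l (ltW s0) Kv; have := ler_wpM2l (ltW s0) vJ.
have := mulr_gt0 s0 e0; lra.
Unshelve. all: by end_near. Qed.

(** Surjectivity half of the inverse function theorem.  For [y] close to [h a],
    the distance from [h] to [y] attains its minimum on a small closed ball
    around [a].  The minimum is not on the bounding sphere, where [h] stays away
    from [h a]; as the derivative is nearly that at [a], the frozen Newton
    direction decreases the distance at any interior point which is not a
    solution. *)
Lemma nbhs_image_invertible_jacobian (R : realType) n
    (h : 'rV[R]_n -> 'rV[R]_n) a U :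
  (\forall x \near a, differentiable h x) ->
  {for a, continuous (jacobian h)} -> jacobian h a \in unitmx ->
  nbhs a U -> nbhs (h a) (h @` U).
Proof.
move=> dh cJ uJ aU; set J := jacobian h a in uJ.
pose K := n%:R * `|invmx J| + 1.
have K0 : 0 < K by rewrite ltr_wpDl// mulr_ge0.
(* [d] makes [n * |v| * d <= |h c - y| / 4] for the Newton direction [v]. *)
pose d := (4 * (n.+1%:R * K))^-1.
have d0 : 0 < d by rewrite invr_gt0 !mulr_gt0.
have nearJ : \forall x \near a, `|J - jacobian h x| <= d.
  by move/cvgrPdist_le: cJ; exact.
have aneq := differentiable_locally_neq (nbhs_singleton dh) uJ.
have [r] := (nbhs_closedballP _ _).1
  (filterI (filterI aU dh) (filterI nearJ aneq)).
have : 0 < r%:num by [].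
move: (r%:num) => {}r r0.
rewrite closed_ballE// => Br.
pose B := closed_ball_ (fun x : 'rV[R]_n => `|x|) a r.
pose S := [set x : 'rV[R]_n | `|a - x| = r].
have cnorm : continuous (fun x : 'rV[R]_n => `|a - x|).
  by move=> x; exact: (cvg_norm (cvgB (cvg_cst a) (@cvg_id _ (nbhs x)))).
have bB : bounded_set B.
  exists (`|a| + r); split; first by rewrite realE addr_ge0// ltW.
  move=> z /ltW rz x /= Bx; apply: le_trans rz.
  by rewrite -[x](subKr a) (le_trans (ler_normB _ _))// lerD2l.
have SB : S `<=` B by move=> x /= Sx; rewrite /B /closed_ball_ /= Sx.
have Bcompact : compact B.
  apply: bounded_closed_compact => //.
  have -> : B = closed_ball a r by rewrite closed_ballE.
  exact: closed_ball_closed.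
have Scompact : compact S.
  apply: subclosed_compact Bcompact SB.
  have -> : S = (fun x => `|a - x|) @^-1` [set r] by [].
  by apply: preimage_closed.
have hcont x : B x -> {for x, continuous h}.
  by move=> /Br[[_ ?] _]; exact: differentiable_continuous.
have Sfar : \forall y \near h a, forall x, S x -> `|h a - y| < `|h x - y|.
  move/compact_near_coveringP/near_covering_withinP: Scompact.
  move=> /(_ _ (nbhs (h a)) (fun y x => `|h a - y| < `|h x - y|) _); apply.
  move=> x Sx.
  have hxa : h x != h a.
    have [_ [_ /= neq]] := Br _ (SB _ Sx).
    apply: neq; apply: contraTneq r0 => xa.
    by rewrite -Sx xa subrr normr0 ltxx.
  pose e := `|h x - h a| / 3.
  have e0 : 0 < e by rewrite divr_gt0// normr_gt0 subr_eq0.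
  exists ([set x' | `|h x - h x'| < e], [set y | `|h a - y| < e]) => /=.
    split; first by move/cvgrPdist_lt: (hcont x (SB _ Sx)); exact.
    by apply/nbhs_ballP; exists e => // y; rewrite -ball_normE.
  move=> [x' y] /= [x'e ye] _; apply: (lt_trans ye).
  have := ler_distD (h x') (h x) (h a).
  have := ler_distD y (h x') (h a).
  rewrite [`|y - _|]distrC; rewrite /e in x'e ye *; lra.
apply: filterS Sfar => y Sfar.
have cf : {within B, continuous (fun x => `|h x - y|)}.
  apply: continuous_in_subspaceT => x /set_mem Bx.
  exact: (cvg_norm (cvgB (hcont _ Bx) (cvg_cst y))).
have B0 : B !=set0 by exists a; rewrite /B /closed_ball_ /= subrr normr0 ltW.
have [c /set_mem Bc cmin] := EVT_min_rV B0 Bcompact cf.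
have [[Uc dc] [Jc _]] := Br _ Bc.
exists c => //; apply: contrapT => /eqP hcy.
have cr : `|a - c| < r.
  rewrite lt_neqAle Bc andbT; apply/eqP => /Sfar; apply/negP; rewrite -leNgt.
  by apply: cmin; rewrite inE; rewrite /B /closed_ball_ /= subrr normr0 ltW.
pose v := - ((h c - y) *m invmx J).
have vK : `|v| <= K * `|h c - y|.
  rewrite normrN (le_trans (norm_rowmul _ _))// /K mulrDl mul1r mulrAC lerDl//.
have vJ : `|v *m jacobian h c + (h c - y)| <= `|h c - y| / 4.
  have -> : v *m jacobian h c + (h c - y) = - (v *m (J - jacobian h c)).
    have -> : v *m (J - jacobian h c) = - (h c - y) - v *m jacobian h c.
      have <- : v *m J = - (h c - y) by rewrite mulNmx (mulmxKV uJ).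
      exact: mulmxBr.
    by rewrite -opprD opprK addrC.
  rewrite normrN (le_trans (norm_rowmul _ _))//.
  have -> : `|h c - y| / 4 = n.+1%:R * (K * `|h c - y|) * d.
    by rewrite /d; field; rewrite gt_eqF//= pnatr_eq0.
  by rewrite !ler_pM ?mulr_ge0// ?ler_nat// ltW.
have stay : \forall s \near 0^'+, B (c + s *: v).
  have : `|a - (c + s *: v)| @[s --> 0^'+] --> `|a - c|.
    apply: cvg_at_right_filter.
    have cs : c + s *: v @[s --> (0 : R)] --> c.
      have -> : nbhs c = nbhs (c + (0 : R) *: v) by rewrite scale0r addr0.
      by apply: cvgD; [exact: cvg_cst | apply: cvgZr_tmp; exact: cvg_id].
    exact: (cvg_norm (cvgB (cvg_cst a) cs)).
  by move=> /cvgr_lt/(_ _ cr); apply: filterS => s /ltW.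
have [s [desc Bs]] := filter_ex (filterI (norm_sub_descent dc hcy vJ) stay).
by move: desc; apply/negP; rewrite -leNgt; apply: cmin; rewrite inE.
Qed.

(** * Embeddings are open at interior points *)

Section OpenEmbedding.
Context {R : realType}.

Lemma continuous_at_interior (T S : topologicalType) (A : set T)
    (f : T -> S) x :
  {within A, continuous f} -> nbhs x A -> {for x, continuous f}.
Proof.
move=> /subspace_continuousP cf Ax.
by have := cf x (nbhs_singleton Ax); rewrite within_interior.
Qed.

(** What the inverse of the chart around [x] satisfies when [x] is an interior
    point.  In this form it passes to products and holds for the torus. *)
Definition local_parametrization (M : topologicalType) n (c : charts R M n) x :=
  [/\ cinv c x (cmap c x x) = x, {for cmap c x x, continuous (cinv c x)} &
      \forall v \near cmap c x x,
        cdom c x (cinv c x v) /\ cmap c x (cinv c x v) = v].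

Lemma interior_local_parametrization (M : topologicalType) n
    (c : charts R M n) x :
  C1_manifold c -> interior_point c x -> local_parametrization c x.
Proof.
move=> [cdomP ccont cK _ _] intx; have [odom domx] := cdomP x.
split; first exact: cK.
  have [_ inv_cont] := ccont x.
  exact: continuous_at_interior inv_cont intx.
by apply: filterS intx => _ [y domy <-]; rewrite cK.
Qed.

Lemma prod_local_parametrization (M1 M2 : topologicalType) n1 n2
    (c1 : charts R M1 n1) (c2 : charts R M2 n2) x :
  local_parametrization c1 x.1 -> local_parametrization c2 x.2 ->
  local_parametrization (prod_charts c1 c2) x.
Proof.
move=> [inv1 cont1 loc1] [inv2 cont2 loc2].
have cvgl : lsubmx v @[v --> cmap (prod_charts c1 c2) x x] --> cmap c1 x.1 x.1.
  rewrite -[X in _ --> X](row_mxKl _ (cmap c2 x.2 x.2)).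
  exact: continuous_lsubmx.
have cvgr : rsubmx v @[v --> cmap (prod_charts c1 c2) x x] --> cmap c2 x.2 x.2.
  rewrite -[X in _ --> X](row_mxKr (cmap c1 x.1 x.1)).
  exact: continuous_rsubmx.
split=> /=.
- by rewrite row_mxKl row_mxKr inv1 inv2; case: (x).
- rewrite /prop_for /continuous_at /= row_mxKl row_mxKr.
  exact: (cvg_pair (cvg_comp _ _ cvgl cont1) (cvg_comp _ _ cvgr cont2)).
- near=> v.
  have [d1 e1] : cdom c1 x.1 (cinv c1 x.1 (lsubmx v)) /\
      cmap c1 x.1 (cinv c1 x.1 (lsubmx v)) = lsubmx v.
    by near: v; exact: cvgl loc1.
  have [d2 e2] : cdom c2 x.2 (cinv c2 x.2 (rsubmx v)) /\
      cmap c2 x.2 (cinv c2 x.2 (rsubmx v)) = rsubmx v.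
    by near: v; exact: cvgr loc2.
  by rewrite e1 e2 hsubmxK.
Unshelve. all: by end_near. Qed.

(** The derivative [tmap] is that of some C^1 extension of the expression of [h]
    in the charts.  At an interior point the extension agrees with this
    expression on a neighborhood, so that the inverse function theorem applies to
    [h] itself. *)
Lemma nbhs_image_C1_embedding (M1 M2 : topologicalType) n (c1 : charts R M1 n)
    (c2 : charts R M2 n) h x U :
  C1_manifold c2 -> local_parametrization c1 x -> C1_map c1 c2 h ->
  row_free (tmap c1 c2 h x) -> nbhs x U -> nbhs (h x) (h @` U).
Proof.
move=> [cdomP ccont cK _ _] [invx cont_inv loc] [cont_h C1h].
rewrite /tmap /deriv_in; set D := local_dom c1 c2 h x.
set phi := local_expr c1 c2 h x; set a := cmap c1 x x in cont_inv loc invx *.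
have [H HC1] : exists H, C1_extension D phi a H by exact: C1h.
have := @xgetPex _ 0
  [set J | exists2 h, C1_extension D phi a h & J = jacobian h a].
move=> /(_ (ex_intro _ _ (ex_intro2 _ _ _ HC1 erefl))).
set J := xget _ _ => -[{HC1}H [dH eqH] ->]; rewrite row_free_unit => uJ Ux.
have [oy yy] := cdomP (h x).
have cont_hinv : h (cinv c1 x v) @[v --> a] --> h x.
  by rewrite -{2}invx; apply: cvg_comp cont_inv (cont_h _).
have domy : \forall v \near a, cdom c2 (h x) (h (cinv c1 x v)).
  apply: cont_hinv; exact: open_nbhs_nbhs.
pose P v := [/\ U (cinv c1 x v), cdom c2 (h x) (h (cinv c1 x v)) & H v = phi v].
have nearH : \forall v \near a, P v.
  near=> v.
  have [dv ev] : cdom c1 x (cinv c1 x v) /\ cmap c1 x (cinv c1 x v) = v.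
    by near: v.
  split; [near: v|near: v; exact: domy|].
    by apply: cont_inv; rewrite invx.
  have Dv : D v by exists (cinv c1 x v) => //; split => //; near: v.
  have eqHv : D v -> H v = phi v by near: v; exact: eqH.
  exact: eqHv.
have Ea : cmap c2 (h x) (h x) = H a.
  by have [_ _ ->] := nbhs_singleton nearH; rewrite /phi /local_expr /= invx.
have := nbhs_image_invertible_jacobian _ _ uJ nearH.
have dH1 : \forall v \near a, differentiable H v by apply: filterS dH => v [].
have [_ cJ] := nbhs_singleton dH.
move=> /(_ dH1 cJ) nHa.
have [cont_c2 _] := ccont (h x).
have : \forall y \near h x,
    cdom c2 (h x) y /\ (H @` [set v | P v]) (cmap c2 (h x) y).
  apply: filterI; first exact: open_nbhs_nbhs.
  rewrite -Ea in nHa.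
  have cc : cmap c2 (h x) y @[y --> h x] --> cmap c2 (h x) (h x).
    exact: continuous_at_interior cont_c2 (open_nbhs_nbhs (conj oy yy)).
  have := cc _ nHa; apply: filterS => y /=; exact.
apply: filterS => y [dy [v [Uv dv Hv] vy]].
exists (cinv c1 x v) => //.
by rewrite -(cK _ _ dy) -vy Hv /phi /local_expr /= cK.
Unshelve. all: by end_near. Qed.

End OpenEmbedding.

(** * The torus *)

Section TorusTopology.
Context {R : realType} {k : nat}.
Local Open Scope quotient_scope.

Lemma torus_pi_eqP (u v : 'rV[R]_k) :
  \pi_(torus R k) u = \pi_(torus R k) v <->
  forall i, u 0 i - v 0 i \is a Num.int.
Proof.
have -> : (\pi_(torus R k) u = \pi_(torus R k) v) =
  (u = v %[mod {eq_quot lattice_equiv_rel R k}]) by [].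
have -> : (u = v %[mod {eq_quot lattice_equiv_rel R k}]) <-> lattice_equiv u v.
  by split=> /eqmodP.
by split=> /forallP.
Qed.

Lemma torus_pi_continuous :
  continuous (\pi_(torus R k) : 'rV[R]_k -> torus R k).
Proof. exact: pi_continuous. Qed.

Lemma torus_compact : compact [set: torus R k].
Proof.
pose I := [set v : 'rV[R]_k | forall i, `[0, 1]%classic (v ord0 i)].
have <- : (\pi_(torus R k) : 'rV[R]_k -> torus R k) @` I = setT.
  apply/seteqP; split=> // t _; rewrite -[t]reprK.
  pose v : 'rV[R]_k := repr t.
  exists (\row_i (v 0 i - (Num.floor (v 0 i))%:~R)).
    move=> i; rewrite /= mxE in_itv/= subr_ge0 floor_le/=.
    by rewrite lerBlDr addrC -intrD1 ltW// floorD1_gt.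
  apply/torus_pi_eqP => i; rewrite mxE addrAC subrr add0r rpredN.
  exact: intr_int.
apply: continuous_compact; last first.
  exact: (@rV_compact R k (fun=> `[0, 1]%classic)
                      (fun=> @segment_compact R 0 1)).
exact/continuous_subspaceT/torus_pi_continuous.
Qed.

Lemma ball_torus_pi_inj (a u v : 'rV[R]_k) :
  ball a 2^-1 u -> ball a 2^-1 v ->
  \pi_(torus R k) u = \pi_(torus R k) v -> u = v.
Proof.
move=> [_ au] [_ av] /torus_pi_eqP uv; apply/rowP => i.
have := au 0 i; have := av 0 i; rewrite /ball /= => avi aui.
apply/eqP; rewrite -subr_eq0; have /intrP[z zE] := uv i.
rewrite zE intr_eq0 -normr_le0 -ltzD1 add0r -(ltr_int R) intr_norm -zE.
rewrite (le_lt_trans (ler_distD (a 0 i) _ _))// (splitr 1) mul1r.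
by rewrite ltrD // distrC.
Qed.

Lemma torus_local_parametrization (t : torus R k) :
  local_parametrization (torus_charts R k) t.
Proof.
have in_ball : ball (repr t : 'rV[R]_k) 2^-1 (repr t).
  by apply: ballxx; rewrite invr_gt0.
have chartK v : ball (repr t : 'rV[R]_k) 2^-1 v ->
    cmap (torus_charts R k) t (\pi_(torus R k) v) = v.
  move=> bv /=; have := @xgetPex _ (repr t : 'rV[R]_k)
    [set u | ball (repr t : 'rV[R]_k) 2^-1 u /\
             \pi_(torus R k) u = \pi_(torus R k) v].
  move=> /(_ (ex_intro _ v (conj bv erefl))) [bu eu].
  exact: ball_torus_pi_inj bu bv eu.
have tE : cmap (torus_charts R k) t t = repr t by rewrite -{2}[t]reprK chartK.
split; rewrite ?tE; first by rewrite /= reprK.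
  exact: torus_pi_continuous.
near=> v; have bv : ball (repr t : 'rV[R]_k) 2^-1 v.
  by near: v; apply: nbhsx_ballx; rewrite invr_gt0.
by split; [exists v | exact: chartK].
Unshelve. all: by end_near. Qed.

End TorusTopology.

(** * Non-wandering sets and basic sets *)

Lemma iter_modn (T : Type) (h : T -> T) x p n :
  iter p h x = x -> iter (n %% p) h x = iter n h x.
Proof.
move=> px; rewrite {2}(divn_eq n p) addnC iterD; congr (iter _ h _).
by elim: (n %/ p)%N => // d IHd; rewrite mulSn iterD -IHd.
Qed.

Lemma periodic_finite (T : Type) (h : T -> T) x p :
  (0 < p)%N -> iter p h x = x -> finite_set [set iter i h x | i in setT].
Proof.
move=> p0 px; apply: (@sub_finite_set _ _ ((fun i => iter i h x) @` `I_p)).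
  by move=> _ [n _ <-]; exists (n %% p)%N; [exact: ltn_pmod|exact: iter_modn].
exact/finite_image/finite_II.
Qed.

Section Pieces.
Context {M : topologicalType}.
Implicit Types (f : M -> M) (A B : set M).

Lemma continuous_iter f n : continuous f -> continuous (iter n f).
Proof.
move=> cf; elim: n => [|n IHn] x /=; first exact: cvg_id.
by apply: continuous_comp; [exact: IHn|exact: cf].
Qed.

Lemma nonwandering_closed f : closed (nonwandering f).
Proof.
move=> x clx U /nbhs_interior /clx[y [NWy Uy]].
by have := NWy _ Uy.
Qed.

Lemma periodic_nonwandering f : periodic_point f `<=` nonwandering f.
Proof.
move=> x [p p0 px] U /nbhs_singleton Ux; exists p => //.
by exists x; split=> //; exists x.
Qed.

Lemma nonwandering_step f x :
  continuous f -> nonwandering f x -> nonwandering f (f x).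
Proof.
move=> cf NWx U /cf /NWx[m m0 [_ [[y Uy <-] Umy]]].
exists m => //; exists (f (iter m f y)); split=> //.
by exists (f y) => //; rewrite -iterSr iterS.
Qed.

Lemma nonwandering_image f fV : continuous f -> continuous fV ->
  cancel f fV -> cancel fV f -> f @` nonwandering f = nonwandering f.
Proof.
move=> cf cV fK VK; apply/seteqP; split=> [_ [x NWx <-]|x NWx].
  exact: nonwandering_step.
exists (fV x) => // U /= UVx.
have Ux : nbhs x (fV @^-1` U) by exact: cV.
have [m m0 [_ [[y Uy <-] Umy]]] := NWx _ Ux.
exists m => //; exists (fV (iter m f y)); split=> //.
exists (fV y) => //.
by apply: (can_inj fK); rewrite VK -iterS iterSr VK.
Qed.

Lemma piece_isolated f D A : invariant_partition f D -> D A ->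
  exists2 U, open U & U `&` nonwandering f = A.
Proof.
move=> [Dfin Dtriv Dcov Dinv] DA.
exists (~` \bigcup_(B in D `\ A) B).
  apply: closed_openC; apply: closed_bigcup; first exact: finite_setD.
  by move=> B [/Dinv[]].
rewrite -Dcov; apply/seteqP; split=> [x [nB [B DB Bx]]|x Ax].
  have [<-//|BA] := pselect (B = A).
  by exfalso; apply: nB; exists B.
split; last by exists A.
by move=> [B [DB BA] Bx]; apply: BA; apply: Dtriv => //; exists x.
Qed.

(** The partition into [A] and its complement suffices to make [A] a basic set:
    transitivity is asked of [A] only. *)
Lemma basic_set_of_isolated f fV A U : continuous f -> continuous fV ->
  cancel f fV -> cancel fV f ->
  open U -> U `&` nonwandering f = A -> closed A -> f @` A = A ->
  has_dense_orbit f A -> basic_set f A.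
Proof.
move=> cf cV fK VK oU UA clA fA dA; split=> //.
exists [set A; nonwandering f `\` A]; last by left.
split.
- exact: finite_set2.
- move=> B C [->|->] [->|->] //; first by move=> [x [Ax [_ /(_ Ax)]]].
  by move=> [x [[_ nAx] /nAx]].
- rewrite bigcup_setU !bigcup_set1 setDUK// -UA.
  exact: subIsetr.
move=> _ [->|->] //; split.
  have -> : nonwandering f `\` A = nonwandering f `&` ~` U.
    rewrite -UA; apply/seteqP; split=> x [NWx nU]; split=> //.
      by move=> Ux; apply: nU.
    by move=> [].
  by apply: closedI; [exact: nonwandering_closed | exact: open_closedC].
have NWf := nonwandering_image cf cV fK VK.
apply/seteqP; split=> [_ [x [NWx nAx] <-]|y [NWy nAy]].
  split; first exact: nonwandering_step.
  by rewrite -fA => -[z Az /(can_inj fK) zx]; apply: nAx; rewrite -zx.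
have [x NWx xy] : (f @` nonwandering f) y by rewrite NWf.
exists x => //; split=> // Ax; apply: nAy.
by rewrite -fA -xy; exists x.
Qed.

(** A dense orbit of [B] stays in one piece of the partition to which [A]
    belongs; this piece contains [B], hence meets [A], hence is [A]. *)
Lemma basic_set_sub_eq f A B :
  basic_set f A -> basic_set f B -> A `<=` B -> A = B.
Proof.
move=> [[x [_ Ax _]] [D partD DA]] [[y [oy By cly]] [D' partD' D'B]] AB.
have NWy i : nonwandering f (y i).
  by have [_ _ <- _] := partD'; exists B.
have [C DC Cy] := orbit_in_piece partD oy NWy.
have BC : B `<=` C.
  have [_ _ _ /(_ C DC)[cC _]] := partD.
  apply: subset_trans cly _; rewrite [X in _ `<=` X](closure_id C).1 //.
  by apply: closureS => _ [i _ <-].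
have AC : A = C.
  have [_ Dtriv _ _] := partD; apply: Dtriv => //.
  by exists (x 0); split => //; exact/BC/AB.
by apply/seteqP; split=> //; rewrite [X in _ `<=` X]AC.
Qed.

Lemma orbit_iter f (x : int -> M) i n :
  is_orbit f x -> x (i + n%:Z) = iter n f (x i).
Proof.
move=> ox; elim: n => [|n IHn]; first by rewrite addr0.
by rewrite -addn1 PoszD addrA ox IHn addn1.
Qed.

Lemma orbit_shift f (x : int -> M) i :
  is_orbit f x -> is_orbit f (fun j => x (j + i)).
Proof. by move=> ox j; rewrite /= addrAC ox. Qed.

Lemma periodic_orbit_range f (x : int -> M) p : (0 < p)%N -> is_orbit f x ->
  (forall i, x (i + p%:Z) = x i) -> range x = [set iter i f (x 0) | i in setT].
Proof.
move=> p0 ox xp; apply/seteqP; split=> [_ [i _ <-]|_ [n _ <-]]; last first.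
  by exists n%:Z => //; rewrite -[n%:Z]add0r (orbit_iter _ _ ox).
have xMp (m : nat) : x (i + m%:Z * p%:Z) = x i.
  elim: m => [|m IHm]; first by rewrite mul0r addr0.
  by rewrite -addn1 PoszD mulrDl mul1r addrA xp.
(* Adding [|i|] periods to the index [i] makes it nonnegative. *)
have [n inE] : exists n : nat, i + (absz i)%:Z * p%:Z = n%:Z.
  case: p p0 {xp xMp} => // p _; set j := i + _; exists (absz j).
  rewrite gez0_abs// /j intS mulrDr mulr1 addrA addr_ge0 ?mulr_ge0//.
  by rewrite abszE -lerBlDl sub0r -normrN ler_norm.
by exists n => //; rewrite -orbit_iter// add0r -inE xMp.
Qed.

Lemma periodic_orbit f s p : (0 < p)%N -> iter p f s = s ->
  exists x : int -> M,
    [/\ is_orbit f x, x 0 = s & forall i, x (i + p%:Z) = x i].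
Proof.
move=> p0 ps; pose x (i : int) := iter `|(i %% p)%Z| f s.
have xE n : x n%:Z = iter n f s by rewrite /x modz_nat /= iter_modn.
have xMD i j : x (j * p%:Z + i) = x i by rewrite /x modzMDl.
have pZ : p%:Z != 0 by case: p p0 {ps x xE xMD}.
exists x; split=> [i||i]; last by rewrite addrC -{1}[p%:Z]mul1r xMD.
- have rE : (`|(i %% p)%Z|%N)%:Z = (i %% p)%Z by rewrite gez0_abs// modz_ge0.
  rewrite {1}(divz_eq i p) -addrA xMD -rE -[1]/(1%N%:Z) -PoszD xE addn1 iterS.
  by congr f; rewrite {2}(divz_eq i p) xMD -rE xE.
- exact: (xE 0%N).
Qed.

End Pieces.

(** * The attractor as an inverse limit *)

Section InverseLimit.
Context {R : realType} {k : nat} {N : metricType R}.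
Variables (g : torus R k -> torus R k) (w : torus R k * N -> N).
Local Notation B := (torus R k * N)%type.
Local Notation F := (Defs.skew g w).

Lemma iter_skew1 n (p : B) : (iter n F p).1 = iter n g p.1.
Proof. by elim: n => //= n ->. Qed.

Definition uniformly_attracting := forall e : R, 0 < e ->
  exists n, forall p q : B,
    p.1 = q.1 -> mdist (iter n F p).2 (iter n F q).2 < e.

Lemma compact_mdist_bounded : compact [set: N] ->
  exists D : R, forall x y : N, mdist x y <= D.
Proof.
move=> cN; have [[z0 _]|N0] := pselect ([set: N] !=set0); last first.
  by exists 0 => x; exfalso; apply: N0; exists x.
have [r zr] : exists r : R, forall x, mdist z0 x < r.
  move/compact_near_coveringP : cN.
  move=> /(_ _ (pinfty_nbhs R) (fun r x => mdist z0 x < r) _).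
  case=> [x _|r [_ rP]]; last first.
    by exists (r + 1) => x; apply: (rP (r + 1)) => //; rewrite ltrDl.
  exists (ball x 1, [set r | mdist z0 x + 1 < r]).
    split; first by apply: nbhsx_ballx.
    by apply: nbhs_pinfty_gt; rewrite num_real.
  move=> [x' r] [/=]; rewrite ballEmdist /= => xx' rP; apply: le_lt_trans rP.
  by rewrite (le_trans (metric_triangle z0 x x'))// lerD2l ltW.
exists (r + r) => x y; rewrite (le_trans (metric_triangle x z0 y))//.
by rewrite metric_sym lerD// ltW.
Qed.

(** The exponential bound on the diameters of the images of the fibers is
    informative because the diameter of the compact [N] is finite. *)
Lemma smale_uniformly_attracting (lam C : R) : compact [set: N] ->
  0 < lam < 1 -> 0 < C ->
  (forall t (j : nat), (0 < j)%N ->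
    (fiber_diam (iter j F @` fiber t)
       <= (C * lam ^+ j)%:E * fiber_diam (fiber (N := N) t))%E) ->
  uniformly_attracting.
Proof.
move=> /compact_mdist_bounded[D mD] /andP[lam0 lam1] C0 contr e e0.
have D0 : 0 < `|D| + 1 by rewrite ltr_wpDl.
have /cvgr0Pnorm_lt/(_ (e / (C * (`|D| + 1)))) : GRing.exp lam @ \oo --> 0.
  by apply: cvg_expr; rewrite gtr0_norm.
rewrite divr_gt0// ?mulr_gt0// => /(_ isT) [n _ nP].
exists n.+1 => p q pq.
have fib (p' : B) : p'.1 = p.1 ->
    (snd @` (iter n.+1 F @` fiber p.1)) (iter n.+1 F p').2.
  by move=> p'p; exists (iter n.+1 F p') => //; exists p'.
have : ((mdist (iter n.+1 F p).2 (iter n.+1 F q).2)%:E <=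
    fiber_diam (iter n.+1 F @` fiber p.1))%E.
  apply: ereal_sup_ubound.
  by exists ((iter n.+1 F p).2, (iter n.+1 F q).2) => //; split; apply: fib.
move=> /le_trans /(_ (contr _ _ (ltn0Sn n))) le1.
rewrite -lte_fin; apply: (le_lt_trans le1).
have diam_le : (fiber_diam (fiber (N := N) p.1) <= (`|D| + 1)%:E)%E.
  apply: ge_ereal_sup => _ [[x y] _ <-] /=.
  by rewrite lee_fin (le_trans (mD x y))// (le_trans (ler_norm _))// lerDl.
have Cl0 : (0 <= (C * lam ^+ n.+1)%:E)%E.
  by rewrite lee_fin mulr_ge0 ?exprn_ge0// ltW.
apply: (le_lt_trans (lee_wpmul2l Cl0 diam_le)).
rewrite -EFinM lte_fin mulrAC -ltr_pdivlMl ?mulr_gt0// mulrC.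
have := nP n.+1 (leqnSn n); rewrite /= ger0_norm ?exprn_ge0// ltW//.
Qed.

(** Two lifts at time [i] are images of two points of the fiber over time
    [i - n] under the [n]-th iterate, hence arbitrarily close. *)
Lemma orbit_lift_unique (X Y : int -> B) : uniformly_attracting ->
  is_orbit F X -> is_orbit F Y -> (forall i, (X i).1 = (Y i).1) -> X =1 Y.
Proof.
move=> attr oX oY XY i.
suff XY2 : (X i).2 = (Y i).2.
  by rewrite [LHS]surjective_pairing XY XY2 -surjective_pairing.
apply: mdist_positivity; apply/eqP; rewrite eq_le mdist_ge0 andbT.
apply/ler_addgt0Pl => e e0; rewrite addr0.
have [n /(_ _ _ (XY (i - n%:Z)))/ltW] := attr e e0.
by rewrite -!orbit_iter// subrK.
Qed.

(** The point over [x i] is the intersection of the decreasing sequence of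
    compact sets [A i n], the images of the fibers over [x (i - n)] under the
    [n]-th iterates; attraction makes it unique, hence the choices for different
    [i] form an orbit. *)
Lemma orbit_lift (x : int -> torus R k) :
  uniformly_attracting -> continuous F -> hausdorff_space B ->
  compact [set: N] -> [set: N] !=set0 -> is_orbit g x ->
  exists2 X : int -> B, is_orbit F X & forall i, (X i).1 = x i.
Proof.
move=> attr cF hB cN [z0 _] ox.
pose A i n := iter n F @` fiber (x (i - n%:Z)).
have Auniq i p q : (forall n, A i n p) -> (forall n, A i n q) -> p = q.
  move=> Ap Aq; have p1 : p.1 = x i.
    by have [r + <-] := Ap 0%N; rewrite /fiber /= subr0.
  have q1 : q.1 = x i by have [r + <-] := Aq 0%N; rewrite /fiber /= subr0.
  suff pq2 : p.2 = q.2.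
    by rewrite [LHS]surjective_pairing p1 -q1 pq2 -surjective_pairing.
  apply: mdist_positivity; apply/eqP; rewrite eq_le mdist_ge0 andbT.
  apply/ler_addgt0Pl => e e0; rewrite addr0 ltW//.
  have [n nP] := attr e e0.
  have [p' p'1 <-] := Ap n; have [q' q'1 <-] := Aq n.
  by apply: nP; rewrite p'1 q'1.
have Aclosed i n : closed (A i n).
  apply: compact_closed => //; apply: continuous_compact.
    exact/continuous_subspaceT/continuous_iter.
  have -> : fiber (x (i - n%:Z)) = (fun z : N => (x (i - n%:Z), z)) @` setT.
    apply/seteqP; split=> [[t z] /= <-|_ [z _ <-] //].
    by exists z.
  apply: continuous_compact cN; apply: continuous_subspaceT => z.
  exact: (cvg_pair (cvg_cst (x (i - n%:Z))) (@cvg_id _ (nbhs z))).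
have Anonempty i : exists p, forall n, A i n p.
  pose y n := iter n F (x (i - n%:Z), z0).
  have cB : compact [set: B].
    by rewrite -setXTT; apply: compact_setX => //; exact: torus_compact.
  have [p [_ clp]] := cB (y @ \oo) _ filterT.
  exists p => n; apply: Aclosed; move: clp; rewrite clusterE; apply.
  exists n => // m /= nm; exists (iter (m - n) F (x (i - m%:Z), z0)).
    rewrite /fiber /= iter_skew1 -orbit_iter//; congr x.
    by rewrite -subzn// addrA subrK.
  by rewrite -iterD subnKC.
pose X i := projT1 (cid (Anonempty i)).
have XA i : forall n, A i n (X i) := projT2 (cid (Anonempty i)).
have X1 i : (X i).1 = x i by have [r + <-] := XA i 0%N; rewrite /fiber /= subr0.
exists X => // i; apply: (Auniq (i + 1)) => // -[|n].
  exists (F (X i)) => //; rewrite /fiber /= subr0 ox.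
  by rewrite X1.
have [q q1 qX] := XA i n; exists q; last by rewrite /= qX.
rewrite /fiber /= in q1 *.
by rewrite q1; congr x; rewrite -addn1 PoszD opprD addrACA subrr addr0.
Qed.

(** The neighborhoods of a point of the inverse limit are conditions on a single
    coordinate of the past: for [n] large the image of the fiber over the
    coordinate of index [- n] is small, hence contained in [W], and by compactness
    of [N] so are the images of the neighboring fibers. *)
Lemma nbhs_cylinder (X : int -> B) W :
  uniformly_attracting -> continuous F -> compact [set: N] ->
  is_orbit F X -> nbhs (X 0) W ->
  exists n V, nbhs (X (- n%:Z)).1 V /\ forall p : B, V p.1 -> W (iter n F p).
Proof.
move=> attr cF cN oX /nbhs_interior.
move=> [[V0 V1] /= [V0x /nbhs_ballP[e /= e0 eV1]] VW].
have [n nP] := attr e e0; exists n; set t := (X (- n%:Z)).1.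
have XE : X 0 = iter n F (X (- n%:Z)) by rewrite -orbit_iter// addNr.
exists (fun t' => forall z, W (iter n F (t', z))).
split; last by move=> [t' z] /=.
suff : \forall t' \near t, [set: N] `<=` (fun z => W (iter n F (t', z))).
  by apply: filterS => t' Wt' z; exact: Wt'.
move/compact_near_coveringP : cN.
move=> /(_ _ (nbhs t) (fun t' z => W (iter n F (t', z))) _); apply=> z _.
have Wtz : W° (iter n F (t, z)).
  apply: VW; split=> /=.
    by rewrite iter_skew1 /= /t -iter_skew1 -XE; exact: nbhs_singleton.
  by apply: eV1; rewrite ballEmdist /= XE; exact: nP.
have := continuous_iter (n := n) cF Wtz.
case=> -[U1 U2] /= [U1t U2z] UW.
by exists (U2, U1) => // -[z' t'] /= [Uz Ut]; exact: (UW (t', z')).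
Qed.

End InverseLimit.

(** * The basic set over a basic set of the base *)

Lemma NegzS1 n : Negz n.+1 + 1 = Negz n :> int.
Proof. by rewrite !NegzE -[n.+2]addn1 PoszD opprD subrK. Qed.

Section NaturalExtension.
Context {R : realType} {k : nat} {N : metricType R} {M : topologicalType}.
Variables (g : torus R k -> torus R k) (w : torus R k * N -> N).
Variables (f fV : M -> M) (emb : torus R k * N -> M).
Local Notation B := (torus R k * N)%type.
Local Notation F := (Defs.skew g w).

Hypotheses (N0 : [set: N] !=set0) (cN : compact [set: N]).
Hypotheses (hM : hausdorff_space M).
Hypotheses (cF : continuous F) (injF : injective F).
Hypotheses (attr : uniformly_attracting g w).
Hypotheses (cf : continuous f) (cfV : continuous fV).
Hypotheses (fK : cancel f fV) (fVK : cancel fV f).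
Hypotheses (cemb : continuous emb) (inj_emb : injective emb).
Hypothesis emb_nbhs : forall p U, nbhs (F p) U -> nbhs (emb (F p)) (emb @` U).
Hypothesis f_emb : forall p, f (emb p) = emb (F p).

(** The inverse limit of the restriction of [g] to [Om], seen in the attractor:
    [p] lies over [Om] together with its whole past and future. *)
Definition natural_extension (Om : set (torus R k)) : set B :=
  [set p | exists X, [/\ is_orbit F X, X 0 = p & forall i, Om (X i).1]].

Let S := attractor g w.

Lemma hausdorff_bundle : hausdorff_space B.
Proof.
move=> p q pq; apply: inj_emb; apply: hM => U V Up Vq.
have [r [Ur Vr]] := pq _ _ (cemb Up) (cemb Vq).
by exists (emb r).
Qed.

Lemma hausdorff_base : hausdorff_space (torus R k).
Proof.
have [z _] := N0 => s t st.
have cz (t' : torus R k) :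
    (fun u : torus R k => (u, z)) x @[x --> t'] --> (t', z).
  exact: (cvg_pair (@cvg_id _ (nbhs t')) (cvg_cst z)).
suff [] : (s, z) = (t, z) by [].
apply: hausdorff_bundle => U V Us Vt.
have [r [Ur Vr]] := st _ _ (cz s _ Us) (cz t _ Vt).
by exists (r, z).
Qed.

Lemma iter_f_emb n p : iter n f (emb p) = emb (iter n F p).
Proof. by elim: n => //= n ->; rewrite f_emb. Qed.

Lemma orbit_attractor (X : int -> B) i : is_orbit F X -> S (X i).
Proof.
by move=> oX l _; exists (X (i - l%:Z)) => //; rewrite -orbit_iter// subrK.
Qed.

Lemma attractor_orbit p : S p -> exists2 X, is_orbit F X & X 0 = p.
Proof.
move=> Sp; have ex n : exists q, iter n F q = p.
  by have [q _ <-] := Sp n I; exists q.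
pose Y n := projT1 (cid (ex n)).
have YE n : iter n F (Y n) = p := projT2 (cid (ex n)).
have FY n : F (Y n.+1) = Y n.
  have inj_iter m : injective (iter m F).
    by elim: m => // m IHm q r /= /injF/IHm.
  by apply: (inj_iter n); rewrite YE -iterSr YE.
exists (fun i => match i with
  | Posz n => iter n F p | Negz n => Y n.+1 end) => //.
move=> [n|[|n]].
- by rewrite -PoszD addn1.
- by rewrite NegzE addNr FY; exact/esym/(YE 0%N).
- by rewrite NegzS1 FY.
Qed.

Lemma attractor_closed : closed S.
Proof.
apply: closed_bigI => l _; apply: compact_closed; first exact: hausdorff_bundle.
apply: continuous_compact; first exact/continuous_subspaceT/continuous_iter.
by rewrite -setXTT; apply: compact_setX => //; exact: torus_compact.
Qed.

Lemma emb_closed (A : set B) : closed A -> closed (emb @` A).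
Proof.
move=> cA; apply: compact_closed => //; apply: continuous_compact.
  exact: continuous_subspaceT.
apply: (subclosed_compact cA) (subsetT _).
by rewrite -setXTT; apply: compact_setX => //; exact: torus_compact.
Qed.

Lemma attractor_sub_range p : S p -> exists q, p = F q.
Proof. by move=> /(_ 1%N I)[q _ <-]; exists q. Qed.

(** The preimage of a neighborhood of [p.1] under the projection is a
    neighborhood of [p] in the bundle, and its image in [M] is one of [emb p]
    because [p], lying in the image of [F], is an interior point. *)
Lemma nonwandering_base p : S p -> nonwandering f (emb p) -> nonwandering g p.1.
Proof.
move=> /attractor_sub_range[q ->] NW U Uq.
have : nbhs (F q) (fst @^-1` U) by exact: cvg_fst.
move=> /emb_nbhs /NW[m m0 [_ [[_ [r Ur <-] <-] [r' Ur']]]].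
rewrite iter_f_emb => /inj_emb rr'; exists m => //.
exists (iter m g r.1); split; first by exists r.1.
by rewrite -(iter_skew1 g w) -rr'.
Qed.

Lemma nonwandering_orbit (X : int -> B) : is_orbit F X ->
  nonwandering f (emb (X 0)) -> forall i, nonwandering f (emb (X i)).
Proof.
move=> oX NW0.
have NWf := nonwandering_image cf cfV fK fVK.
have back i : nonwandering f (emb (X (i + 1))) -> nonwandering f (emb (X i)).
  rewrite oX -f_emb -{1}NWf => -[y NWy /(can_inj fK) <-//].
move=> [n|n].
  elim: n => // n IHn; rewrite -addn1 PoszD oX -f_emb.
  exact: nonwandering_step.
by elim: n => [|n IHn]; apply: back; rewrite ?NegzS1// NegzE addNr.
Qed.

Lemma natural_extension_orbit_dense (Om : set (torus R k)) (X : int -> B) :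
  is_orbit F X -> Om `<=` closure (range (fun i => (X i).1)) ->
  natural_extension Om `<=` closure (range X).
Proof.
move=> oX dX _ [Y [oY <- YOm]] W /(nbhs_cylinder attr cF cN oY)[n [V [Vn VW]]].
have [_ [[j _ <-] Vj]] := dX _ (YOm _) _ Vn.
exists (iter n F (X j)); split; last exact: VW.
by exists (j + n%:Z) => //; rewrite (orbit_iter _ _ oX).
Qed.

(** The lift of a periodic orbit is periodic with the same period, because its
    translate by the period is another lift. *)
Lemma lift_periodic_point s p : (0 < p)%N -> iter p g s = s ->
  exists X : int -> B, [/\ is_orbit F X, (X 0).1 = s, iter p F (X 0) = X 0,
    range X = [set iter i F (X 0) | i in setT] &
    range (fun i => (X i).1) = [set iter i g s | i in setT]].
Proof.
move=> p0 ps; have [x [ox x0 xp]] := periodic_orbit p0 ps.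
have [X oX X1] := orbit_lift attr cF hausdorff_bundle cN N0 ox.
have Xp i : X (i + p%:Z) = X i.
  apply: (orbit_lift_unique attr (orbit_shift p%:Z oX) oX).
  by move=> j; rewrite !X1 xp.
have Xpp : iter p F (X 0) = X 0 by rewrite -orbit_iter.
exists X; split=> //; first by rewrite X1.
  exact: periodic_orbit_range oX Xp.
rewrite -x0 -(periodic_orbit_range p0 ox xp).
by congr (_ @` _); apply/funext => i; rewrite X1.
Qed.

Lemma natural_extension_sub (Om : set (torus R k)) :
  natural_extension Om `<=` S `&` fst @^-1` Om.
Proof.
by move=> _ [X [oX <- XOm]]; split; [exact: orbit_attractor | exact: XOm].
Qed.

Lemma natural_extension_image (Om : set (torus R k)) :
  f @` (emb @` natural_extension Om) = emb @` natural_extension Om.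
Proof.
apply/seteqP; split=> [_ [_ [_ [X [oX <- XOm]] <-] <-]|_ [_ [X [oX <- XOm]] <-]].
  exists (X 1); last by rewrite f_emb -oX add0r.
  exists (fun i => X (i + 1)).
  by split=> [||i]; [exact: orbit_shift|rewrite add0r|exact: XOm].
exists (emb (X (- 1))); last by rewrite f_emb -oX addNr.
exists (X (- 1)) => //.
exists (fun i => X (i - 1)).
by split=> [||i]; [exact: orbit_shift|rewrite add0r|exact: XOm].
Qed.

Lemma emb_periodic p : periodic_point F p <-> periodic_point f (emb p).
Proof.
split=> -[n n0 np]; exists n => //; first by rewrite iter_f_emb np.
by apply: inj_emb; rewrite -iter_f_emb.
Qed.

Lemma periodic_attractor p : periodic_point F p -> S p.
Proof.
move=> [n n0 np] l _; exists (iter (l * n - l) F p) => //.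
rewrite -iterD subnKC; last by rewrite leq_pmulr.
by elim: l => // l IHl; rewrite mulSn iterD IHl.
Qed.

Section Piece.
Variables (D : set (set (torus R k))) (Om : set (torus R k)).
Hypotheses (partD : invariant_partition g D) (DOm : D Om).
Hypothesis per_g : nonwandering g `<=` closure (periodic_point g).
Hypothesis per_f : nonwandering f `<=` closure (periodic_point f).

Lemma piece_sub_nonwandering : Om `<=` nonwandering g.
Proof. by have [_ _ <- _] := partD => t; exists Om. Qed.

Lemma piece_closed : closed Om.
Proof. by have [_ _ _ /(_ Om DOm)[]] := partD. Qed.

(** Follow a periodic point of [g] close to a remote past coordinate of the
    given point: the [n]-th image of its lift is close to that point. *)
Lemma natural_extension_periodic :
  natural_extension Om `<=` closure (periodic_point F).
Proof.
move=> _ [X [oX <- XOm]] W /(nbhs_cylinder attr cF cN oX)[n [V [Vn VW]]].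
have [s [[p p0 ps] Vs]] := per_g (piece_sub_nonwandering (XOm _)) Vn.
have [Y [oY Y0 Yp _ _]] := lift_periodic_point p0 ps.
exists (iter n F (Y 0)); split; last by apply: VW; rewrite Y0.
by exists p => //; rewrite -iterD addnC iterD Yp.
Qed.

Lemma natural_extension_nonwandering :
  emb @` natural_extension Om `<=` nonwandering f.
Proof.
move=> _ [p /natural_extension_periodic pF <-]; apply: nonwandering_closed => U.
move=> /cemb /pF[q [qper Uq]]; exists (emb q); split=> //.
by apply: periodic_nonwandering; exact/emb_periodic.
Qed.

Lemma natural_extensionE : emb @` natural_extension Om =
  nonwandering f `&` emb @` (S `&` fst @^-1` Om).
Proof.
apply/seteqP; split=> [x xO|x [NWx [p [Sp Omp] px]]].
  split; first exact: natural_extension_nonwandering.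
  by have [p Op <-] := xO; exists p => //; exact: natural_extension_sub.
exists p => //; have [X oX X0] := attractor_orbit Sp; exists X; split=> //.
have NWX i : nonwandering g (X i).1.
  apply: nonwandering_base; first exact: orbit_attractor.
  by apply: nonwandering_orbit => //; rewrite X0 px.
have oX1 : is_orbit g (fun i => (X i).1) by move=> i; rewrite oX.
have [A DA AX] := orbit_in_piece partD oX1 NWX.
have [_ Dtriv _ _] := partD.
by rewrite (Dtriv Om A)//; exists p.1; split=> //; rewrite -X0.
Qed.

Lemma natural_extension_closed : closed (emb @` natural_extension Om).
Proof.
rewrite natural_extensionE; apply: closedI; first exact: nonwandering_closed.
apply: emb_closed; apply: closedI; first exact: attractor_closed.
apply: preimage_closed; [by move=> p _; exact: cvg_fst|exact: piece_closed].
Qed.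

(** Near [emb p] the periodic points of [f] lie in [emb @` S]: a periodic point
    in the range of [emb] is its own image under iterates of arbitrarily large
    order. *)
Lemma nonwandering_attractor p : nbhs (emb p) (range emb) ->
  nonwandering f (emb p) -> S p.
Proof.
move=> rp NWp; suff [q Sq /inj_emb <-//] : (emb @` S) (emb p).
apply: emb_closed; first exact: attractor_closed.
move=> U Up; have [x [perx [Ux [q _ qx]]]] := per_f NWp (filterI Up rp).
exists x; split=> //; exists q => //.
by apply: periodic_attractor; apply/emb_periodic; rewrite qx.
Qed.

(** An open set [V] isolating [Om] in the non-wandering set of [g] is pulled back
    to the bundle and pushed to [M]. *)
Lemma natural_extension_isolated :
  exists2 U, open U & U `&` nonwandering f = emb @` natural_extension Om.
Proof.
have [V oV VOm] := piece_isolated partD DOm.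
exists (emb @` (fst @^-1` V))°; first exact: open_interior.
apply/seteqP; split=> [x [Vx NWx]|x xO].
  have [p Vp px] := interior_subset Vx; rewrite natural_extensionE; split=> //.
  have Sp : S p.
    apply: nonwandering_attractor; rewrite px//.
    by apply: filterS Vx => _ [q _ <-]; exists q.
  exists p => //; split=> //; rewrite /= -VOm; split=> //.
  by apply: nonwandering_base => //; rewrite px.
split; last exact: natural_extension_nonwandering.
have [p /natural_extension_sub[Sp Omp] <-] := xO.
have [q pq] := attractor_sub_range Sp; rewrite pq; apply: emb_nbhs; rewrite -pq.
have cfst : fst @ p --> p.1 by exact: cvg_fst.
apply: cfst; apply: open_nbhs_nbhs; split=> //.
by have [] : (V `&` nonwandering g) p.1 by rewrite VOm.
Qed.

Lemma natural_extension_basic_set : has_dense_orbit g Om ->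
  basic_set f (emb @` natural_extension Om).
Proof.
move=> [x [ox Omx dx]].
have [U oU UO] := natural_extension_isolated.
apply: (basic_set_of_isolated cf cfV fK fVK oU UO).
- exact: natural_extension_closed.
- exact: natural_extension_image.
have [X oX X1] := orbit_lift attr cF hausdorff_bundle cN N0 ox.
exists (emb \o X); split=> [i|i|_ [p Op <-]].
- by rewrite /= oX f_emb.
- exists (X i) => //; exists (fun j => X (j + i)); split=> [||j].
  + exact: orbit_shift.
  + by rewrite add0r.
  + by rewrite X1.
- move=> W /cemb Wp.
  have dX : Om `<=` closure (range (fun i => (X i).1)).
    by have -> : (fun i => (X i).1) = x by apply/funext.
  have [_ [[i _ <-] Wi]] := natural_extension_orbit_dense oX dX Op Wp.
  by exists (emb (X i)); split=> //; exists i.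
Qed.

Lemma natural_extension_trivial :
  trivial_set g Om -> trivial_set f (emb @` natural_extension Om).
Proof.
move=> [[s [[p p0 ps] OmE]] _]; split; last exact: natural_extension_isolated.
have [X [oX X0 Xp rX rX1]] := lift_periodic_point p0 ps.
exists (emb (X 0)); split; first by exists p => //; rewrite iter_f_emb Xp.
have XOm i : Om (X i).1 by rewrite OmE -rX1; exists i.
have NE : natural_extension Om = range X.
  apply/seteqP; split=> [q Oq|_ [i _ <-]]; last first.
    exists (fun j => X (j + i)).
    by split=> [||j]; [exact: orbit_shift|rewrite add0r|exact: XOm].
  have : closure (range X) q.
    apply: natural_extension_orbit_dense Oq; rewrite // rX1 -OmE.
    exact: subset_closure.
  suff clX : closed (range X) by move=> /clX.
  apply: accessible_finite_set_closed.1.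
    exact/hausdorff_accessible/hausdorff_bundle.
  by rewrite rX; exact: periodic_finite p0 Xp.
rewrite NE rX; apply/seteqP; split=> [_ [_ [n _ <-] <-]|_ [n _ <-]].
  by exists n => //; rewrite iter_f_emb.
by rewrite iter_f_emb; exists (iter n F (X 0)) => //; exists n.
Qed.

(** A dense orbit of [Om] lifts into the periodic orbit of [q], hence runs
    through the finite, closed orbit of [q.1], which contains its closure. *)
Lemma trivial_of_natural_extension : has_dense_orbit g Om ->
  trivial_set f (emb @` natural_extension Om) -> trivial_set g Om.
Proof.
move=> [x [ox Omx dx]] [[y [py yE]] _].
split; last exact: piece_isolated partD DOm.
have [q Oq qy] : (emb @` natural_extension Om) y by rewrite yE; exists 0%N.
have qE : natural_extension Om = [set iter i F q | i in setT].
  apply/seteqP; split=> [r Or|_ [n _ <-]].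
    have : (emb @` natural_extension Om) (emb r) by exists r.
    by rewrite yE -qy => -[n _]; rewrite iter_f_emb => /inj_emb <-; exists n.
  have [r Or] : (emb @` natural_extension Om) (emb (iter n F q)).
    by rewrite yE -iter_f_emb qy; exists n.
  by move=> /inj_emb <-.
have [p p0 pq] : periodic_point F q by apply/emb_periodic; rewrite qy.
have pq1 : iter p g q.1 = q.1 by rewrite -(iter_skew1 g w) pq.
exists q.1; split; first by exists p.
have [X oX X1] := orbit_lift attr cF hausdorff_bundle cN N0 ox.
apply/seteqP; split=> [t /dx|_ [n _ <-]]; last first.
  rewrite -(iter_skew1 g w).
  have : natural_extension Om (iter n F q) by rewrite qE; exists n.
  by move=> /natural_extension_sub[].
have clq : closed [set iter i g q.1 | i in setT].
  apply: accessible_finite_set_closed.1 (periodic_finite p0 pq1).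
  exact/hausdorff_accessible/hausdorff_base.
suff /closureS sub : range x `<=` [set iter i g q.1 | i in setT].
  by move=> /sub /clq.
move=> _ [i _ <-]; rewrite -X1.
have : natural_extension Om (X i).
  exists (fun j => X (j + i)).
  by split=> [||j]; [exact: orbit_shift|rewrite add0r|rewrite X1].
by rewrite qE => -[n _ <-]; rewrite iter_skew1; exists n.
Qed.

Lemma natural_extension_backward : g @^-1` Om = Om ->
  natural_extension Om = S `&` fst @^-1` Om.
Proof.
move=> backOm; apply/seteqP; split; first exact: natural_extension_sub.
move=> p [Sp Omp]; have [X oX X0] := attractor_orbit Sp; exists X; split=> //.
have step i : Om (X (i + 1)).1 <-> Om (X i).1 by rewrite oX /= -{2}backOm.
have Om0 : Om (X 0).1 by rewrite X0.
move=> [n|n].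
  by elim: n => // n /step; rewrite -PoszD addn1.
by elim: n => [|n IHn]; apply/step; rewrite ?NegzS1// NegzE addNr.
Qed.

End Piece.

End NaturalExtension.

(** On a periodic orbit [g] is injective, so that a point [s] of a backward
    invariant periodic orbit has a single preimage.  The values of a nonsingular
    map are all regular, and the sum of signs over this single preimage is at
    most 1. *)
Lemma backward_invariant_not_trivial (R : realType) (k : nat)
    (g : torus R k -> torus R k) (d : nat) (Om : set (torus R k)) :
  nonsingular (torus_charts R k) g -> has_degree g d -> (2 <= d)%N ->
  g @^-1` Om = Om -> ~ trivial_set g Om.
Proof.
move=> nsg deg d2 backOm [[s [[p p0 ps] OmE]] _].
have jac0 t : torus_jacobian g t != 0 by have := nsg t; rewrite unitmxE unitfE.
have fib : g @^-1` [set s] = [set iter p.-1 g s].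
  apply/seteqP; split=> [t /= gt|_ ->]; last by rewrite /= -iterS prednK.
  have : Om t by rewrite -backOm /= gt OmE; exists 0%N.
  rewrite OmE => -[n _ tn]; rewrite -gt -iterSr prednK//.
  by rewrite -tn -iterD addnC iterD ps.
have := deg s (fun t _ => jac0 t); rewrite fib fsbig_set1 => sgd.
have : d%:R <= 1 :> R.
  by rewrite -sgd (le_trans (ler_norm _))// normr_sg jac0.
by rewrite (ler_nat R d 1) leqNgt d2.
Qed.

Theorem theorem1 (R : realType) (k m : nat) (hk : (0 < k)%N) (hm : (0 < m)%N)
    (M : topologicalType) (cM : charts R M (k + m))
    (N : metricType R) (cN : charts R N m) (qN : N -> 'M[R]_m)
    (f : M -> M) (emb : torus R k * N -> M)
    (g : torus R k -> torus R k) (w : torus R k * N -> N)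
    (hM : closed_manifold cM)
    (hN : compact_riemannian_manifold_with_boundary cN qN)
    (hf : A_diffeomorphism cM f)
    (hsv : smale_vietoris cN cM f emb g w)
    (hg : A_endomorphism (torus_charts R k) g)
    (Om : set (torus R k)) (hOm : basic_set g Om) :
  let K := emb @` (attractor g w `&` fst @^-1` Om) in
  exists OmS : set M,
    [/\ unique (fun O => basic_set f O /\ O `<=` K) OmS,
        trivial_set g Om -> trivial_set f OmS,
        ~ trivial_set g Om -> ~ trivial_set f OmS &
        g @^-1` Om = Om -> ~ trivial_set g Om /\ OmS = K].
Proof.
move=> K; have [manM hausM _ _] := hM.
have [manN cptN [z0 _] _ _] := hN.
have N0 : [set: N] !=set0 by exists z0.
have [_ _ per_f] := hf; have [[_ _ nsg _] per_g _] := hg.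
have [[[cf _] [fV [fK fVK [cfV _]]]] [Cemb inj_emb rk_emb _] skewF f_emb] := hsv.
have [[[cF _] injF _ _] [d d2 [_ _ _ _ deg]] fibw attrF] := skewF.
have [lam [C [lam01 C0 contr]]] := attrF.
have attr := smale_uniformly_attracting cptN lam01 C0 contr.
have emb_nbhs p U : nbhs (Defs.skew g w p) U ->
    nbhs (emb (Defs.skew g w p)) (emb @` U).
  apply: nbhs_image_C1_embedding manM _ Cemb (rk_emb _).
  apply: prod_local_parametrization; first exact: torus_local_parametrization.
  apply: interior_local_parametrization => //=.
  by have [_] := fibw p.1; rewrite (surjective_pairing p).
have cemb : continuous emb := Cemb.1.
have [dense_Om [D partD DOm]] := hOm.
have NE := natural_extensionE N0 cptN hausM cF injF attr cf cfV fK fVK cemb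
  inj_emb emb_nbhs f_emb partD DOm per_g.
have basic := natural_extension_basic_set N0 cptN hausM cF injF attr cf cfV fK
  fVK cemb inj_emb emb_nbhs f_emb partD DOm per_g per_f dense_Om.
exists (emb @` natural_extension g w Om); split.
- split; first by split=> //; rewrite NE; exact: subIsetr.
  move=> O [basicO OK]; apply/esym; apply: (basic_set_sub_eq basicO basic).
  rewrite NE => x Ox; split; last exact: OK.
  by have [_ [D' [_ _ <- _] D'O]] := basicO; exists O.
- exact: (natural_extension_trivial N0 cptN hausM cF injF attr cf cfV fK fVK cemb
    inj_emb emb_nbhs f_emb partD DOm per_g per_f).
- move=> ntOm trivS; apply: ntOm.
  exact: (trivial_of_natural_extension N0 cptN hausM cF attr cemb inj_emb f_emb
    partD DOm dense_Om trivS).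
- move=> backOm; split.
    exact: backward_invariant_not_trivial nsg deg d2 backOm.
  by rewrite (natural_extension_backward injF backOm).
Qed.
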